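(* Let $n\ge 1$, let $A=\operatorname{Diag}(a_1I_{m_1},\dots,a_sI_{m_s})$ and $B=\operatorname{Diag}(b_1I_{n_1},\dots,b_tI_{n_t})$ be real $n\times n$ matrices with $a_1<\cdots<a_s$, $b_1<\cdots<b_t$, $m_i,n_j\ge1$ and $\sum_im_i=\sum_jn_j=n$. Let $f:O(n)\to\mathbb{R}$, $f(X)=\operatorname{Tr}(AXBX^T)$. For each perfect filling $\epsilon$, let $F_\epsilon$ be the image of the map $\Phi_\epsilon:O(\overline{m})\times O(\overline{n})\to O(n)$ (a subset of the critical locus of $f$; the critical locus is the disjoint union of the $F_\epsilon$). Then the index of the Hessian of $f$ is constant on $F_\epsilon$, and is given by $$\sum_{(i,j)<(k,l)}\epsilon_{ij}\epsilon_{kl},$$ where $(i,j)<(k,l)$ means $i<k$ and $j<l$.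
   Context: $\operatorname{Diag}$ denotes a (block-)diagonal matrix. The Hessian of $f$ at a critical point $X$ is the symmetric bilinear form on $T_XO(n)$ given by the second derivative of $f$; its index is the maximal dimension of a subspace on which it is negative definite. A perfect filling is an $s\times t$ matrix $\epsilon=(\epsilon_{ij})$ with entries in $\{0,1,2,\dots\}$ such that $\sum_{j}\epsilon_{ij}=m_i$ for each $i\in\{1,\dots,s\}$ and $\sum_i\epsilon_{ij}=n_j$ for each $j\in\{1,\dots,t\}$. Set $O(\overline{m})=\prod_{i=1}^sO(m_i)$, $O(\overline{n})=\prod_{j=1}^tO(n_j)$. Given $Q=(Q[1],\dots,Q[s])\in O(\overline{m})$, $R=(R[1],\dots,R[t])\in O(\overline{n})$ and a perfect filling $\epsilon$, write $Q[i]=(Q[i,1]\ \cdots\ Q[i,t])$ with $Q[i,j]$ of size $m_i\times\epsilon_{ij}$ and $R[j]=(R[1,j]\ \cdots\ R[s,j])$ with $R[i,j]$ of size $n_j\times\epsilon_{ij}$. Then $\Phi_\epsilon(Q,R)$ is the $n\times n$ matrix whose $(i,j)$ block ($1\le i\le s$, $1\le j\le t$) is the $m_i\times n_j$ matrix $Q[i,j]R[i,j]^T$. *)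

(* Defs.v *)
From HB Require Import structures.
From mathcomp Require Import all_boot all_order all_algebra.
From mathcomp Require Import all_classical all_reals all_analysis.

Set Implicit Arguments.
Unset Strict Implicit.
Unset Printing Implicit Defensive.

Import Order.TTheory GRing.Theory Num.Theory.
Import numFieldNormedType.Exports.

Local Open Scope ring_scope.
Local Open Scope classical_set_scope.

Definition orthogonal_group (R : realType) (n : nat) : set 'M[R]_n :=
  [set X | X *m X^T = 1%:M].
Arguments orthogonal_group : clear implicits.

Section CriticalPoints.
Variables (R : realType) (n : nat).
Implicit Types (X : 'M[R]_n) (f : 'M[R]_n -> R) (c : R -> 'M[R]_n).

(* Only the germ of c at 0 matters; two derivatives at 0 are what is needed
   for f \o c to have a second derivative at 0. *)
Definition orthogonal_curve X c : Prop :=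
  [/\ c 0 = X,
      \forall u \near (0 : R), orthogonal_group R n (c u),
      \forall u \near (0 : R), derivable c u 1 &
      derivable c^`() 0 1].

Definition tangent_space X : set 'M[R]_n :=
  [set H | exists2 c, orthogonal_curve X c & c^`() 0 = H].

(* In the next two definitions f stands for its restriction to O(n): its values
   away from O(n) play no role. *)
Definition critical_point f X : Prop :=
  orthogonal_group R n X /\
  forall c, orthogonal_curve X c -> is_derive (0 : R) 1 (f \o c) 0.

(* The Hessian of f|O(n) at a critical point X is the symmetric bilinear form on
   T_X O(n) whose value at (c'(0), c'(0)) is (f \o c)''(0).  By polarization this
   determines h on the tangent space; h is stored as a form on the ambient
   space of matrices, where its values off the tangent space are irrelevant. *)
Definition is_hessian f X (h : {symmetric 'M[R]_n}) : Prop :=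
  forall c, orthogonal_curve X c ->
    (\forall u \near (0 : R), derivable (f \o c) u 1) /\
    is_derive (0 : R) 1 (f \o c)^`() (h (c^`() 0) (c^`() 0)).

Definition negative_definite_on (h : {symmetric 'M[R]_n})
    (U : {vspace 'M[R]_n}) : Prop :=
  forall H, H \in U -> H != 0 -> h H H < 0.

Definition has_index (T : set 'M[R]_n) (h : {symmetric 'M[R]_n}) (d : nat) :
    Prop :=
  (exists U : {vspace 'M[R]_n},
     [/\ [set` U] `<=` T, negative_definite_on h U & \dim U = d]) /\
  (forall U : {vspace 'M[R]_n},
     [set` U] `<=` T -> negative_definite_on h U -> (\dim U <= d)%N).

Definition hessian_index f X (d : nat) : Prop :=
  exists2 h : {symmetric 'M[R]_n},
    is_hessian f X h & has_index (tangent_space X) h d.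

Definition trace_function (A B : 'M[R]_n) (X : 'M[R]_n) : R :=
  \tr (A *m X *m B *m X^T).

End CriticalPoints.

Definition block_scalar_mx (R : realType) (n s : nat) (m : 'I_s -> nat)
    (hm : (\sum_(i < s) m i)%N = n) (a : 'I_s -> R) : 'M[R]_n :=
  castmx (hm, hm) (\mxdiag_(i < s) ((a i)%:M : 'M[R]_(m i))).

Definition perfect_filling (s t : nat) (m : 'I_s -> nat) (p : 'I_t -> nat)
    (eps : 'M[nat]_(s, t)) : Prop :=
  (forall i, (\sum_(j < t) eps i j)%N = m i) /\
  (forall j, (\sum_(i < s) eps i j)%N = p j).

Section Phi.
Variables (R : realType) (n s t : nat) (m : 'I_s -> nat) (p : 'I_t -> nat).
Variables (hm : (\sum_(i < s) m i)%N = n) (hp : (\sum_(j < t) p j)%N = n).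
Variables (eps : 'M[nat]_(s, t)) (heps : perfect_filling m p eps).

(* The j-th of the consecutive column blocks of Q i, whose widths are
   eps i 0, eps i 1, and so on; the cast makes the block sizes visible. *)
Definition left_block (Q : forall i, 'M[R]_(m i)) (i : 'I_s) (j : 'I_t) :
    'M[R]_(m i, eps i j) :=
  submxrow (castmx (erefl (m i), esym (heps.1 i)) (Q i)) j.

Definition right_block (P : forall j, 'M[R]_(p j)) (i : 'I_s) (j : 'I_t) :
    'M[R]_(p j, eps i j) :=
  submxrow (castmx (erefl (p j), esym (heps.2 j)) (P j)) i.

Definition Phi (Q : forall i, 'M[R]_(m i)) (P : forall j, 'M[R]_(p j)) :
    'M[R]_n :=
  castmx (hm, hp)
    (\mxblock_(i < s, j < t) (left_block Q i j *m (right_block P i j)^T)).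

Definition F_eps : set 'M[R]_n :=
  [set X | exists Q : forall i, 'M[R]_(m i), exists P : forall j, 'M[R]_(p j),
     [/\ forall i, orthogonal_group R (m i) (Q i),
         forall j, orthogonal_group R (p j) (P j) &
         X = Phi Q P]].

End Phi.
Arguments F_eps R {n s t m p} hm hp {eps} heps _.

(* Main.v *)
Require Import Defs.
From HB Require Import structures.
From mathcomp Require Import all_boot all_order all_algebra.
From mathcomp Require Import all_classical all_reals all_analysis.
From mathcomp Require Import ring lra.

Import Order.TTheory GRing.Theory Num.Theory.
Import numFieldNormedType.Exports.

Local Open Scope ring_scope.
Local Open Scope classical_set_scope.

(* Write X = U V^T where the columns of U (built from Q) are eigenvectors of A
   and those of V (built from R, reordered by the filling) are eigenvectors of
   B: A = U diag(alpha) U^T and B = V diag(beta) V^T, and eps i j counts the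
   positions with (alpha, beta) = (a_i, b_j).  In the coordinates
   W = U^T Y V one has f(Y) = sum alpha_x beta_y W_xy^2, and since W is
   orthogonal, subtracting sum alpha_x beta_x W_xy^2 changes f on O(n) only by
   a constant.  The result is a quadratic form whose polar form vanishes
   against X, so no second-derivative term of the curve survives: X is critical
   and the Hessian is that quadratic form evaluated at the velocity.  Velocities
   are exactly the W that are skew, where the form becomes
   - sum (alpha_x - alpha_y) (beta_x - beta_y) W_xy^2; its index is the number
   of pairs with alpha_x < alpha_y and beta_x < beta_y. *)

(** * Derivatives of sums, products, matrix entries and rational functions *)

Section Differentiation.
Context {R : realType}.

Lemma is_derive_bigsum {I : finType} (F : I -> R -> R) (dF : I -> R) (u : R) :
  (forall i, is_derive u 1 (F i) (dF i)) ->
  is_derive u 1 (fun v => \sum_i F i v) (\sum_i dF i).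
Proof.
move=> dFP; rewrite -(_ : \sum_i F i = (fun v => \sum_i F i v)); last first.
  by apply/funext => v; rewrite fct_sumE.
elim/big_ind2 : _ => // [|f df g dg hf hg]; first exact: is_derive_cst.
exact: is_deriveD.
Qed.

Lemma is_derive_prod (f g : R -> R) (u df dg : R) :
  is_derive u 1 f df -> is_derive u 1 g dg ->
  is_derive u 1 (fun v => f v * g v) (df * g u + f u * dg).
Proof.
move=> hf hg; apply: is_derive_eq (is_deriveM hf hg) _.
by rewrite /GRing.scale/= [g u * df]mulrC addrC.
Qed.

Lemma is_derive_entry {m n k l : nat} (P : 'M[R]_(k, m)) (Q : 'M[R]_(n, l))
    (c : R -> 'M[R]_(m, n)) (u : R) x y :
  derivable c u 1 ->
  is_derive u 1 (fun v => (P *m c v *m Q) x y) ((P *m 'D_1 c u *m Q) x y).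
Proof.
move=> dc; rewrite derive_mx// mxE.
rewrite (_ : (fun v => _) =
    fun v => \sum_j (\sum_i P x i * c v i j) * Q j y); last first.
  by apply/funext => v; rewrite mxE; apply: eq_bigr => j _; rewrite mxE.
apply: is_derive_bigsum => j; rewrite mxE.
rewrite -[X in is_derive _ _ _ X]addr0.
rewrite -[X in is_derive _ _ _ (_ + X)](mulr0 (\sum_i P x i * c u i j)).
apply: is_derive_prod; apply: is_derive_bigsum => i.
rewrite -[X in is_derive _ _ _ X]add0r -[X in is_derive _ _ _ (X + _)](mul0r (c u i j)).
apply: is_derive_prod; rewrite mxE; apply: derivableP.
exact: (derivable_mxP c u 1).1.
Qed.

(** The derivative is again a quotient of polynomials whose denominator has no zeros, so the lemma
    applies to its own output and also yields second derivatives. *)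
Lemma is_derive_rational (p q : {poly R}) (u : R) : (forall v, q.[v] != 0) ->
  is_derive u 1 (fun v => p.[v] / q.[v])
    ((p^`() * q - p * q^`()).[u] / (q ^+ 2).[u]).
Proof.
move=> q0; have dq : derivable (horner q) u 1 by exact: derivable_horner.
have dV : is_derive u 1 (fun v => q.[v]^-1)
    (- q.[u] ^- 2 * q^`().[u]).
  apply: DeriveDef; first exact: (derivableV (q0 u) dq).
  rewrite (deriveV (q0 u) dq).
  by rewrite -derive1E derivE.
apply: is_derive_eq (is_derive_prod _ _ _ _ _ (is_derive_poly p u) dV) _.
rewrite !(hornerM, hornerD, hornerN, horner_exp).
field; exact: q0.
Qed.

End Differentiation.

(** * Tangent vectors realized by the Cayley transform *)

Section Cayley.
Context {R : realType} {n : nat}.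
Implicit Types (K X : 'M[R]_n).

Lemma row_norm_eq0 (v : 'rV[R]_n) : v *m v^T = 0 -> v = 0.
Proof.
move=> /matrixP/(_ 0 0); rewrite !mxE => /eqP.
rewrite psumr_eq0 => [/allP v0|i _]; last by rewrite mxE -expr2 sqr_ge0.
apply/rowP => i; have := v0 i; rewrite mem_index_enum => /(_ isT).
by rewrite !mxE -expr2 sqrf_eq0 => /eqP.
Qed.

(** A row vector [v] in the kernel satisfies [v = v *m K], so [v *m v^T] equals [v *m K *m v^T], a
    skew 1 x 1 matrix, hence zero; so [v = 0]. *)
Lemma unitmx_sub_skew K : K^T = - K -> 1%:M - K \in unitmx.
Proof.
move=> Ksk; rewrite unitmxE unitfE; apply/negP => /det0P[v /eqP v0].
rewrite mulmxBr mulmx1 => /eqP; rewrite subr_eq0 => /eqP vK.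
apply/v0/row_norm_eq0; rewrite {1}vK; apply/matrixP => i j.
set M := _ *m _; have Msk : M^T = - M.
  by rewrite /M !trmx_mul trmxK Ksk mulNmx mulmxN mulmxA.
rewrite !ord1 mxE; have := congr1 (fun Z : 'M[R]_1 => Z 0 0) Msk.
by rewrite !mxE => /=; lra.
Qed.

Lemma skew_tangent K X : K^T = - K -> orthogonal_group R n X ->
  tangent_space X (K *m X).
Proof.
(* [N u] enters the Cayley curve twice, once inverted and once transposed, and each occurrence
   contributes [L *m X] to the velocity at 0; hence the factor one half. *)
move=> Ksk XO; pose L : 'M[R]_n := 2^-1 *: K.
pose N (u : R) := 1%:M - u *: L.
have uLsk u : (u *: L)^T = - (u *: L) by rewrite !linearZ/= Ksk !scalerN.
have NU u : N u \in unitmx by exact: unitmx_sub_skew.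
have NT u : (N u)^T = 1%:M + u *: L.
  by rewrite [LHS]linearB/= trmx1 uLsk opprK.
have NN u : N u *m (N u)^T = (N u)^T *m N u.
  rewrite NT !(mulmxBl, mulmxBr, mulmxDl, mulmxDr, mul1mx, mulmx1).
  by rewrite opprD !addrA addrK.
(* [PN] is [N] over the polynomial ring: its determinant [q] is a common denominator without real
   zeros, and its adjugate supplies the numerators, so the entries of the curve are rational in
   [u]. *)
pose PN : 'M[{poly R}]_n := 1%:M - 'X *: map_mx polyC L.
have PNE u : map_mx (horner_eval u) PN = N u.
  apply/matrixP => i j; rewrite !mxE /horner_eval !hornerE.
  by case: (i == j); rewrite ?mulr1n ?mulr0n !hornerE.
pose q := \det PN.
have qE u : q.[u] = \det (N u) by rewrite -PNE det_map_mx.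
have q0 u : q.[u] != 0 by rewrite qE -unitfE -unitmxE.
pose d u := invmx (N u) *m (K *m X).
pose D := \adj PN *m map_mx polyC (K *m X).
have dE u i j : d u i j = (D i j).[u] / q.[u].
  rewrite /d /invmx NU -scalemxAl mxE -qE mulrC; congr (_ / _).
  have -> : (D i j).[u] = map_mx (horner_eval u) D i j by rewrite [RHS]mxE.
  have polyCK Z : map_mx (horner_eval u) (map_mx polyC Z) = Z :> 'M[R]_n.
    by apply/matrixP => k l; rewrite !mxE /horner_eval hornerC.
  by rewrite map_mxM map_mx_adj PNE polyCK.
(* This is the Cayley curve (N u)^-1 (N u)^T X (see Nc), in a form whose
   derivative at 0 is d 0. *)
pose c u := X + u *: d u.
have KE : K = L + L by rewrite -scalerDl -[2^-1]mul1r -splitr scale1r.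
have Nc u : N u *m c u = (N u)^T *m X.
  rewrite mulmxDr -scalemxAr mulKVmx// NT mulmxBl mulmxDl mul1mx
    -!(scalemxAl u L).
  by rewrite [in u *: (K *m X)]KE mulmxDl scalerDr addrA subrK.
have cdE u i j : c u i j = X i j + u * d u i j.
  by rewrite mxE [X in _ + X]mxE.
have cE u i j : c u i j = ((X i j)%:P * q + 'X * D i j).[u] / q.[u].
  by rewrite cdE dE !(hornerD, hornerM, hornerC, hornerX) mulrDl mulfK// mulrA.
have dcE u i j := is_derive_rational ((X i j)%:P * q + 'X * D i j) q u q0.
have cF i j : (fun u => c u i j) =
    fun u => ((X i j)%:P * q + 'X * D i j).[u] / q.[u].
  by apply/funext => u.
have dc u : derivable c u 1.
  by apply/derivable_mxP => i j; rewrite cF; have [] := dcE u i j.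
exists c.
  split.
  - by rewrite /c scale0r addr0.
  - exists 1 => //= u _; rewrite /orthogonal_group/=.
    have -> : c u = invmx (N u) *m ((N u)^T *m X).
      by rewrite -Nc mulKmx.
    rewrite !trmx_mul trmxK -!mulmxA (mulmxA X) (XO : X *m X^T = 1%:M) mul1mx.
    rewrite (mulmxA (N u)^T) -NN trmx_inv -mulmxA mulKmx//.
    by rewrite mulmxV// unitmx_tr.
  - by exists 1 => /=.
  - apply/derivable_mxP => i j.
    rewrite (_ : (fun u => _) = fun u => 'D_1 (fun v => c v i j) u); last first.
      by apply/funext => u; rewrite derive1E derive_mx// mxE.
    rewrite cF (_ : (fun u => _) =
        fun u => (((X i j)%:P * q + 'X * D i j)^`() * q
          - ((X i j)%:P * q + 'X * D i j) * q^`()).[u] / (q ^+ 2).[u]).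
      have [|//] := is_derive_rational
        (((X i j)%:P * q + 'X * D i j)^`() * q
          - ((X i j)%:P * q + 'X * D i j) * q^`()) (q ^+ 2) 0.
      by move=> v; rewrite horner_exp expf_neq0.
    by apply/funext => u; have [_ ->] := dcE u i j.
rewrite derive1E derive_mx//; apply/matrixP => i j; rewrite mxE.
have dd : is_derive (0 : R) 1 (fun u => X i j + u * (d u i j)) (d 0 i j).
  rewrite (_ : (fun u => _) = fun u => X i j + u * ((D i j).[u] / q.[u])); last first.
    by apply/funext => u; rewrite dE.
  have := is_deriveD (is_derive_cst (X i j) (0 : R) 1)
   (is_derive_prod _ _ _ _ _ (is_derive_id (0 : R) 1)
     (is_derive_rational (D i j) q 0 q0)).
  by rewrite mul0r addr0 add0r mul1r -dE.
rewrite (_ : (fun u => c u i j) = fun u => X i j + u * d u i j); last first.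
  by apply/funext => u; rewrite cdE.
have [_ ->] := dd.
by rewrite /d /N scale0r subr0 invmx1 mul1mx.
Qed.

End Cayley.

(** * Weighted forms in the coordinates [U^T *m Y *m V], and when they are Hessians *)

Definition weighted_form {R : realType} {n : nat} (U V : 'M[R]_n)
    (g : 'I_n -> 'I_n -> R) (Y Z : 'M[R]_n) : R :=
  \sum_x \sum_y g x y * ((U^T *m Y *m V) x y * (U^T *m Z *m V) x y).

Lemma weighted_formC {R : realType} {n : nat} (U V : 'M[R]_n) g Y Z :
  weighted_form U V g Y Z = weighted_form U V g Z Y.
Proof. by do 2![apply: eq_bigr => ? _]; rewrite [X in _ * X]mulrC. Qed.

Lemma weighted_form_linear {R : realType} {n : nat} (U V : 'M[R]_n) g Y :
  linear_for *%R (weighted_form U V g Y).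
Proof.
move=> k Z1 Z2; rewrite /weighted_form mulr_sumr -big_split/=.
apply: eq_bigr => x _; rewrite mulr_sumr -big_split/=; apply: eq_bigr => y _.
rewrite mulmxDr mulmxDl -scalemxAr -scalemxAl.
have entry (P Q : 'M[R]_n) : (k *: P + Q) x y = k * P x y + Q x y.
  by rewrite mxE [X in X + _]mxE.
by rewrite entry; ring.
Qed.

Lemma weighted_form_bilinear {R : realType} {n : nat} (U V : 'M[R]_n) g :
  bilinear_for *%R *%R (weighted_form U V g).
Proof.
split=> Y k Z1 Z2; last exact: weighted_form_linear.
by rewrite !(weighted_formC _ _ _ _ Y) weighted_form_linear.
Qed.

HB.instance Definition _ {R : realType} {n : nat} (U V : 'M[R]_n) g :=
  bilinear_isBilinear.Build R _ _ _ *%R *%R (weighted_form U V g)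
    (weighted_form_bilinear U V g).

(** Sign bit [false] and trivial involution express symmetry in the Hermitian interface; this makes
    the form a [{symmetric 'M[R]_n}], as [is_hessian] requires. *)
Lemma weighted_form_hermitian {R : realType} {n : nat} (U V : 'M[R]_n) g Y Z :
  weighted_form U V g Y Z = (-1) ^+ false * idfun (weighted_form U V g Z Y).
Proof. by rewrite mul1r weighted_formC. Qed.

HB.instance Definition _ {R : realType} {n : nat} (U V : 'M[R]_n) g :=
  isHermitianSesquilinear.Build R _ false idfun (weighted_form U V g)
    (weighted_form_hermitian U V g).

Section WeightedForm.
Context {R : realType} {n : nat} (U V : 'M[R]_n) (g : 'I_n -> 'I_n -> R).
Implicit Types (X : 'M[R]_n) (c d : R -> 'M[R]_n).
Local Notation h := (weighted_form U V g).

Lemma is_derive_weighted_form c d (u : R) :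
  derivable c u 1 -> derivable d u 1 ->
  is_derive u 1 (fun v => h (c v) (d v)) (h ('D_1 c u) (d u) + h (c u) ('D_1 d u)).
Proof.
move=> dc dd; rewrite /weighted_form -big_split/=.
apply: is_derive_bigsum => x; rewrite -big_split/=.
apply: is_derive_bigsum => y; rewrite -mulrDr.
apply: is_derive_eq (is_derive_prod _ _ _ _ _ (is_derive_cst (g x y) u 1)
  (is_derive_prod _ _ _ _ _ (is_derive_entry U^T V c u x y dc)
     (is_derive_entry U^T V d u x y dd))) _.
by rewrite mul0r add0r.
Qed.

(** Along a curve [c] through [X], [f] has derivative [h c' c] and second derivative
    [h c'' c + h c' c']. At 0, where [c] equals [X], every term pairing with [c] vanishes, which
    leaves [h c' c']. *)
Lemma critical_point_hessian_weighted_form (f : 'M[R]_n -> R) X (C : R) :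
  orthogonal_group R n X ->
  (forall Y, orthogonal_group R n Y -> f Y = 2^-1 * h Y Y + C) ->
  (forall Y, h Y X = 0) ->
  critical_point f X /\ is_hessian f X h.
Proof.
move=> XO fE hX.
pose F c (u : R) := 2^-1 * h (c u) (c u) + C.
have dF c u : derivable c u 1 -> is_derive u 1 (F c) (h ('D_1 c u) (c u)).
  move=> dc; have dh := is_derive_prod _ _ _ _ _
    (is_derive_cst (2^-1 : R) u 1) (is_derive_weighted_form c c u dc dc).
  apply: is_derive_eq (is_deriveD dh (is_derive_cst C u 1)) _.
  by rewrite (weighted_formC _ _ _ (c u) ('D_1 c u)) /=; field.
have fF c : orthogonal_curve X c -> \forall u \near (0 : R), F c u = (f \o c) u.
  by move=> [_ cO _ _]; near do rewrite /= fE//.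
split.
  split=> // c cX; apply: near_eq_is_derive (fF c cX) _.
  have [c0 _ dc _] := cX.
  apply: is_derive_eq (dF c 0 (nbhs_singleton dc)) _.
  by rewrite c0 hX.
move=> c cX; have [c0 cO dc ddc] := cX.
(* Equality near 0 becomes equality near each [u] close to 0, so that the first derivatives agree on
   a neighbourhood and can be differentiated again. *)
have fFF := near_join (fF c cX).
have dfc : \forall u \near (0 : R), is_derive (u : R) 1 (f \o c) (h (derive1 c u) (c u)).
  near=> u; rewrite derive1E; apply: near_eq_is_derive; last apply: dF.
    by near: u.
  by near: u.
split; first by near=> u; have [] : is_derive (u : R) 1 (f \o c) (h (derive1 c u) (c u)) by near: u.
have dc0 := nbhs_singleton dc.
have : is_derive (0 : R) 1 (fun u => h (derive1 c u) (c u)) (h (derive1 c 0) (derive1 c 0)).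
  apply: is_derive_eq (is_derive_weighted_form _ _ _ ddc dc0) _.
  by rewrite c0 hX add0r derive1E.
apply: near_eq_is_derive; near=> u.
have [_ <-] : is_derive (u : R) 1 (f \o c) (h (derive1 c u) (c u)) by near: u.
by rewrite derive1E.
Unshelve. all: by end_near. Qed.

End WeightedForm.

(** Differentiating the entries of [c *m c^T = 1] at 0, where [c] is the identity, gives
    [c' + c'^T = 0]. *)
Lemma orthogonal_curve_skew {R : realType} {n : nat} (c : R -> 'M[R]_n) :
  orthogonal_curve 1%:M c -> (derive1 c 0)^T = - derive1 c 0.
Proof.
move=> [c0 cO dc _]; have dc0 := nbhs_singleton dc.
apply/matrixP => i j; rewrite !mxE.
have ent x y : is_derive (0 : R) 1 (fun u => c u x y) (derive1 c 0 x y).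
  rewrite derive1E derive_mx// mxE; apply: derivableP.
  exact: (derivable_mxP c 0 1).1.
have dS : is_derive (0 : R) 1 (fun u => \sum_k c u i k * c u j k)
    (\sum_k (derive1 c 0 i k * c 0 j k + c 0 i k * derive1 c 0 j k)).
  by apply: is_derive_bigsum => k; exact: is_derive_prod.
have dS0 : is_derive (0 : R) 1 (fun u => \sum_k c u i k * c u j k) 0.
  apply: near_eq_is_derive (is_derive_cst ((i == j)%:R : R) (0 : R) 1).
  near=> u.
  have /matrixP/(_ i j) : c u *m (c u)^T = 1%:M by near: u.
  by rewrite !mxE => <-; apply: eq_bigr => k _; rewrite mxE.
have [_ dSE] := dS; have [_] := dS0; rewrite dSE c0 big_split/=.
rewrite (bigD1 j)//= big1 ?addr0 => [|k kj]; last first.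
  by rewrite mxE eq_sym (negPf kj) mulr0.
rewrite (bigD1 i)//= big1 ?addr0 => [|k ki]; last first.
  by rewrite mxE eq_sym (negPf ki) mul0r.
by rewrite !mxE !eqxx mulr1 mul1r addrC => /eqP; rewrite addr_eq0 => /eqP.
Unshelve. all: by end_near. Qed.

(** * Index at [U *m V^T] when [U] diagonalizes [A] and [V] diagonalizes [B] *)

Section Diagonalized.
Context {R : realType} {n : nat} (U V : 'M[R]_n) (alpha beta : 'rV[R]_n).
Hypotheses (UO : U^T *m U = 1%:M) (VO : V^T *m V = 1%:M).
Implicit Types (H W Y : 'M[R]_n).

Local Notation a x := (alpha 0 x).
Local Notation b x := (beta 0 x).
Local Notation X := (U *m V^T).

Let UO' : U *m U^T = 1%:M. Proof. exact: mulmx1C. Qed.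
Let VO' : V *m V^T = 1%:M. Proof. exact: mulmx1C. Qed.

(* Twice the coefficient alpha_x beta_y of W_xy^2 in f, corrected by
   alpha_x beta_x so that it vanishes on the diagonal. *)
Let weight (x y : 'I_n) : R := 2 * (a x * (b y - b x)).
Local Notation h := (weighted_form U V weight).

Let XO : orthogonal_group R n X.
Proof.
by rewrite /orthogonal_group/= trmx_mul trmxK mulmxA -(mulmxA U) VO mulmx1.
Qed.

(** The map sending [Y] to [U^T *m Y *m V] preserves orthogonality and sends [X] to the identity,
    which reduces the claim to curves through the identity. *)
Lemma skew_of_tangent H : tangent_space X H ->
  (U^T *m H *m V)^T = - (U^T *m H *m V).
Proof.
move=> [c [c0 cO dc ddc] <-].
pose w u := U^T *m c u *m V.
have entry := @is_derive_entry R _ _ _ _ U^T V.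
have dw u : derivable c u 1 -> derivable w u 1 /\ derive1 w u = U^T *m derive1 c u *m V.
  move=> dcu; have dwu : derivable w u 1.
    by apply/derivable_mxP => i j; have [] := entry c u i j dcu.
  split=> //; rewrite !derive1E derive_mx//; apply/matrixP => i j.
  by rewrite mxE; have [_ ->] := entry c u i j dcu.
have [_ <-] := dw 0 (nbhs_singleton dc).
apply: orthogonal_curve_skew; split.
- by rewrite /w c0 !mulmxA UO mul1mx.
- near=> u; have cu : c u *m (c u)^T = 1%:M by near: u.
  rewrite /orthogonal_group/= /w !trmx_mul trmxK !mulmxA.
  by rewrite -(mulmxA _ V) VO' mulmx1 -(mulmxA U^T) cu mulmx1 UO.
- by near=> u; apply: (dw u _).1; near: u.
- apply/derivable_mxP => i j.
  have [dh _] := entry (derive1 c) 0 i j ddc.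
  apply: near_eq_derivable dh; near=> u.
  have [_ ->//] : derivable w u 1 /\ derive1 w u = U^T *m derive1 c u *m V.
    by apply: dw; near: u.
Unshelve. all: by end_near. Qed.

Lemma tangent_of_skew W : W^T = - W -> tangent_space X (U *m W *m V^T).
Proof.
move=> Wsk; have -> : U *m W *m V^T = U *m W *m U^T *m X.
  by rewrite !mulmxA -(mulmxA (U *m W)) UO mulmx1.
apply: skew_tangent XO.
by rewrite !trmx_mul trmxK Wsk mulNmx mulmxN mulmxA.
Qed.

Lemma mulmx_conjK W : U^T *m (U *m W *m V^T) *m V = W.
Proof. by rewrite !mulmxA UO mul1mx -mulmxA VO mulmx1. Qed.

Lemma weighted_form_skew H (W := U^T *m H *m V) : W^T = - W ->
  h H H = - \sum_x \sum_y (a x - a y) * (b x - b y) * W x y ^+ 2.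
Proof.
move=> Wsk; have Wyx x y : W y x = - W x y.
  by have := congr1 (fun M : 'M[R]_n => M x y) Wsk; rewrite !mxE.
(* Average the sum with its transpose. *)
rewrite -[LHS]mul1r -[X in X * _](@divff _ 2) ?pnatr_eq0// -mulrA.
rewrite [2^-1 * _]mulrC mulrA mulr_natl mulr2n.
rewrite {2}/weighted_form exchange_big -big_split mulr_suml -sumrN /=.
apply: eq_bigr => x _; rewrite -big_split mulr_suml -sumrN /=.
apply: eq_bigr => y _; by rewrite -/W Wyx /weight; field.
Qed.

Lemma trace_function_orthogonal Y : orthogonal_group R n Y ->
  trace_function (U *m diag_mx alpha *m U^T) (V *m diag_mx beta *m V^T) Y =
    2^-1 * h Y Y + \sum_x a x * b x.
Proof.
move=> YO; pose W := U^T *m Y *m V.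
have WO : W *m W^T = 1%:M.
  rewrite /W !trmx_mul trmxK !mulmxA -(mulmxA _ V) VO' mulmx1.
  by rewrite -(mulmxA U^T) (YO : Y *m Y^T = 1%:M) mulmx1.
(* Each row of the orthogonal matrix [W] has unit norm. *)
have -> : \sum_x a x * b x = \sum_x \sum_y a x * b x * W x y ^+ 2.
  apply: eq_bigr => x _; rewrite -mulr_sumr.
  have /matrixP/(_ x x) := WO; rewrite !mxE eqxx mulr1n => WE.
  rewrite (_ : \sum_y W x y ^+ 2 = 1) ?mulr1//.
  by rewrite -WE; apply: eq_bigr => y _; rewrite !mxE.

rewrite /weighted_form mulr_sumr -big_split/=.
have -> : trace_function (U *m diag_mx alpha *m U^T) (V *m diag_mx beta *m V^T) Y
  = \tr (diag_mx alpha *m W *m diag_mx beta *m W^T).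
  rewrite /trace_function -!mulmxA mxtrace_mulC /W.
  by rewrite !trmx_mul trmxK !mulmxA.
apply: eq_bigr => x _; rewrite mul_mx_diag mul_diag_mx.
rewrite mulr_sumr -big_split/= mxE; apply: eq_bigr => y _.
by rewrite !mxE -/W /weight; field.
Qed.

(** In these coordinates [X] is the identity, and the weight vanishes on the diagonal. *)
Lemma weighted_form_base Y : h Y X = 0.
Proof.
rewrite /weighted_form !mulmxA UO mul1mx VO.
apply: big1 => x _; apply: big1 => y _; rewrite [1%:M x y]mxE.
by case: (eqVneq x y) => [->|_]; rewrite /weight ?subrr ?mulr0n !(mulr0, mul0r).
Qed.

(** When [(a x - a y) * (b x - b y)] is positive, exactly one of [(x, y)] and [(y, x)] lies in [S],
    so [S] indexes the negative directions. *)
Let S : {set 'I_n * 'I_n} :=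
  [set xy | (a xy.1 < a xy.2) && (b xy.1 < b xy.2)]%SET.

Let row_S (H : 'M[R]_n) : 'rV[R]_#|S| :=
  \row_s (U^T *m H *m V) (enum_val s).1 (enum_val s).2.

Let row_S_linear : linear row_S.
Proof.
move=> k H1 H2; apply/rowP => s.
by rewrite [LHS]mxE mulmxDr mulmxDl -scalemxAr -scalemxAl !mxE.
Qed.

HB.instance Definition _ :=
  GRing.isLinear.Build R 'M[R]_n 'rV[R]_#|S| _ row_S row_S_linear.

Let row_S_eq0 H : row_S H = 0 ->
  forall x y, a x < a y -> b x < b y -> (U^T *m H *m V) x y = 0.
Proof.
move=> /rowP H0 x y axy bxy.
have xyS : (x, y) \in S by rewrite inE axy bxy.
by have := H0 (enum_rank_in xyS (x, y)); rewrite !mxE enum_rankK_in.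
Qed.

(** If the coordinates of a tangent [H] on [S] vanish, so do all those of negative weight, and
    [h H H] is nonnegative. Hence [row_S] is injective on a negative definite space. *)
Lemma negative_dim_le (E : {vspace 'M[R]_n}) : [set` E] `<=` tangent_space X ->
  negative_definite_on h E -> (\dim E <= #|S|)%N.
Proof.
move=> ET Eneg; pose phi := linfun row_S.
have kerE : (E :&: lker phi)%VS = 0%VS.
  apply/eqP; rewrite -subv0; apply/subvP => H; rewrite memv_cap memv_ker memv0.
  move=> /andP[HE]; rewrite lfunE/= => /eqP H0; apply/negPn/negP => Hn0.
  suff /le_lt_trans/(_ (Eneg H HE Hn0)) : 0 <= h H H by rewrite ltxx.
  have Wsk := skew_of_tangent _ (ET H HE).
  rewrite weighted_form_skew// -sumrN; apply: sumr_ge0 => x _.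
  rewrite -sumrN; apply: sumr_ge0 => y _; rewrite oppr_ge0.
  have W0 := row_S_eq0 _ H0.
  have Wyx : (U^T *m H *m V) y x = - (U^T *m H *m V) x y.
    by have := congr1 (fun M : 'M[R]_n => M x y) Wsk; rewrite !mxE.
  have [->|w0] := eqVneq ((U^T *m H *m V) x y) 0.
    by rewrite expr0n mulr0.
  apply: mulr_le0_ge0; last exact: sqr_ge0.
  rewrite leNgt; apply/negP; have [axy|ayx|->] := ltgtP (a x) (a y).
  - rewrite nmulr_rgt0 ?subr_lt0// => /(W0 _ _ axy) wxy.
    by rewrite wxy eqxx in w0.
  - rewrite pmulr_rgt0 ?subr_gt0// => /(W0 _ _ ayx) /eqP.
    by rewrite Wyx oppr_eq0 (negPf w0).
  - by rewrite subrr mul0r ltxx.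
rewrite -(limg_ker_dim phi E) kerE dimv0 add0n.
by rewrite (leq_trans (dimvS (subvf _)))// dimvf dim_matrix mul1r.
Qed.

Let pair (s : 'I_#|S|) : 'I_n * 'I_n := enum_val s.

Let pair_lt s : a (pair s).1 < a (pair s).2 /\ b (pair s).1 < b (pair s).2.
Proof. by have := enum_valP s; rewrite inE => /andP. Qed.

Let skew_delta (s : 'I_#|S|) : 'M[R]_n :=
  delta_mx (pair s).1 (pair s).2 - delta_mx (pair s).2 (pair s).1.

Let skew_deltaE s x y :
  skew_delta s x y = ((x, y) == pair s)%:R - ((y, x) == pair s)%:R.
Proof.
by rewrite !mxE; case: (pair s) => p q; rewrite !xpair_eqE [(y == p) && _]andbC.
Qed.

Let basis : #|S|.-tuple 'M[R]_n := [tuple U *m skew_delta s *m V^T | s < #|S|].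

Let comb (k : 'I_#|S| -> R) : 'M[R]_n := \sum_s k s *: skew_delta s.

Let basis_comb k : \sum_(s < #|S|) k s *: basis`_s = U *m comb k *m V^T.
Proof.
rewrite mulmx_sumr mulmx_suml; apply: eq_bigr => s _.
by rewrite -tnth_nth tnth_mktuple -scalemxAr -scalemxAl.
Qed.

Let comb_skew k : (comb k)^T = - comb k.
Proof.
rewrite linear_sum -sumrN; apply: eq_bigr => s _ /=.
by rewrite linearZ/= linearB/= !trmx_delta -scalerN opprB.
Qed.

(** [S] never contains both a pair and its swap, so at [pair s] only [skew_delta s] contributes.
    This recovers the coefficients and gives freeness of [basis]. *)
Let comb_pair k s : comb k (pair s).1 (pair s).2 = k s.
Proof.
have swap r : ((pair s).2, (pair s).1) == pair r = false.
  apply/eqP => e; have [+ _] := pair_lt r; have [+ _] := pair_lt s.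
  by rewrite -e /= => /lt_trans/[apply]; rewrite ltxx.
rewrite summxE (bigD1 s)//= big1 ?addr0 => [|r rs].
  by rewrite mxE skew_deltaE swap -surjective_pairing eqxx subr0 mulr1.
rewrite mxE skew_deltaE swap -surjective_pairing (inj_eq enum_val_inj).
by rewrite eq_sym (negPf rs) subrr mulr0.
Qed.

(** The entries of [comb k] are supported on [S] and its transpose, where the two differences have
    the same sign. *)
Let comb_sign k x y : 0 <= (a x - a y) * (b x - b y) * comb k x y ^+ 2.
Proof.
have [xyS|xyS] := boolP (((x, y) \in S) || ((y, x) \in S)).
  rewrite mulr_ge0 ?sqr_ge0//; move: xyS; rewrite !inE/=.
  by case/orP => /andP[ax bx]; [rewrite nmulr_rge0 ?subr_lt0// subr_le0 ltW|
    rewrite pmulr_rge0 ?subr_gt0// subr_ge0 ltW].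
rewrite summxE big1 ?expr0n ?mulr0// => s _; rewrite mxE skew_deltaE.
move: xyS; rewrite negb_or => /andP[xyS yxS].
have /negPf -> : (x, y) != pair s.
  by apply: contraNneq xyS => ->; exact: enum_valP.
have /negPf -> : (y, x) != pair s.
  by apply: contraNneq yxS => ->; exact: enum_valP.
by rewrite subrr mulr0.
Qed.

(** The span of [basis] works: on it the form is minus a sum of nonnegative terms, and a nonzero
    coefficient [k s] makes the term at [pair s] strictly positive. *)
Lemma negative_space : exists E : {vspace 'M[R]_n},
  [/\ [set` E] `<=` tangent_space X, negative_definite_on h E & \dim E = #|S|].
Proof.
have coordE H : H \in <<basis>>%VS ->
    H = U *m comb (fun s => coord basis s H) *m V^T.
  by move=> /coord_span {1}->; rewrite basis_comb.
exists <<basis>>%VS; split.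
- by move=> H /= /coordE ->; apply: tangent_of_skew; exact: comb_skew.
- move=> H /coordE; set k := fun s => _ => HE Hn0.
  have [s ks] : exists s, k s != 0.
    apply/existsP; apply: contraNT Hn0; rewrite negb_exists => /forallP k0.
    rewrite HE /comb big1 ?mulmx0 ?mul0mx// => s _.
    by have := k0 s; rewrite negbK => /eqP ->; rewrite scale0r.
  suff : h H H < 0 by [].
  have WE : U^T *m H *m V = comb k by rewrite HE mulmx_conjK.
  rewrite weighted_form_skew WE// oppr_lt0 pair_big/= lt0r.
  rewrite sumr_ge0 ?andbT => [|p _]; last exact: comb_sign.
  rewrite psumr_neq0 => [|p _]; last exact: comb_sign.
  apply/hasP; exists (pair s); rewrite ?mem_index_enum//=.
  have [ax bx] := pair_lt s.
  by rewrite comb_pair pmulr_rgt0 ?exprn_even_gt0// nmulr_rgt0 ?subr_lt0.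
- apply/eqP; rewrite -[X in _ == X](size_tuple basis) -/(free basis).
  apply/freeP => k; rewrite basis_comb => H0 s.
  by rewrite -(comb_pair k) -[comb k]mulmx_conjK H0 mulmx0 mul0mx mxE.
Qed.

Theorem diagonalized_index :
  let f := trace_function (U *m diag_mx alpha *m U^T) (V *m diag_mx beta *m V^T) in
  critical_point f X /\ hessian_index f X
    #|[set xy : 'I_n * 'I_n | (a xy.1 < a xy.2) && (b xy.1 < b xy.2)]%SET|.
Proof.
move=> f; have [fX hX] := critical_point_hessian_weighted_form U V weight f X _
  XO trace_function_orthogonal weighted_form_base.
split=> //; exists h => //; split; first exact: negative_space.
by move=> E; exact: negative_dim_le.
Qed.

End Diagonalized.

(** * Block indices and block-diagonal matrices *)

Lemma big_Rank {T : Type} {idx : T} (op : Monoid.com_law idx) {s : nat}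
    {m : 'I_s -> nat} (F : 'I_(\sum_i m i) -> T) :
  \big[op/idx]_x F x = \big[op/idx]_i \big[op/idx]_(k < m i) F (tagnat.Rank i k).
Proof.
rewrite sig_big_dep (reindex _ tagnat.sig_bij_on)/=.
by apply: eq_bigr => x _; rewrite -tagnat.rankE tagnat.sigK.
Qed.

Lemma mxblock_Rank {T : Type} {s t : nat} {m : 'I_s -> nat} {p : 'I_t -> nat}
    (B : forall i j, 'M[T]_(m i, p j)) i j k l :
  mxblock B (tagnat.Rank i k) (tagnat.Rank j l) = B i j k l.
Proof.
have /matrixP/(_ k l) := mxblockK B i j.
by rewrite [submxblock _ _ _ _ _]mxE.
Qed.

Section BlockDiagonal.
Context {R : realType} {s : nat} {m : 'I_s -> nat}.
Implicit Types D E : forall i, 'M[R]_(m i).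

Lemma mxdiag_Rank D i k l : mxdiag D (tagnat.Rank i k) (tagnat.Rank i l) = D i k l.
Proof.
have /matrixP/(_ k l) := submxblock_diag D i.
by rewrite [submxblock _ _ _ _ _]mxE.
Qed.

Lemma mxdiag_Rank_neq D i j k l : i != j ->
  mxdiag D (tagnat.Rank i k) (tagnat.Rank j l) = 0.
Proof.
move=> ij; have : submxblock (mxdiag D) i j k l = 0.
  by rewrite mxblockK (negPf ij) mxE.
by rewrite [submxblock _ _ _ _ _]mxE.
Qed.

Lemma mul_mxdiag D E : mxdiag D *m mxdiag E = \mxdiag_i (D i *m E i).
Proof.
rewrite [X in _ *m X]/mxdiag mul_mxdiag_mxblock; apply/eq_mxblockP => i j.
by case: eqVneq => [<-|_]; rewrite ?conform_mx_id ?mulmx0.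
Qed.

Lemma mxdiag_orthogonal D : (forall i, orthogonal_group R (m i) (D i)) ->
  mxdiag D *m (mxdiag D)^T = 1%:M.
Proof.
move=> DO; rewrite tr_mxdiag mul_mxdiag -mxdiagZ; apply/eq_mxdiag => i.
exact: DO.
Qed.

Lemma diag_mx_sig1 (a : 'I_s -> R) :
  diag_mx (\row_x a (tagnat.sig1 x)) = \mxdiag_(i < s) ((a i)%:M : 'M[R]_(m i)).
Proof.
rewrite -(eq_mxdiag (fun i => diag_const_mx (m i) (a i))) -diag_mxrow.
by congr diag_mx; apply/rowP => x; rewrite !mxE.
Qed.

(** Within block [i] the diagonal matrix is scalar, so it commutes with [D i], and [D i] cancels
    against its transpose. *)
Lemma mxdiag_conj D (a : 'I_s -> R) :
  (forall i, orthogonal_group R (m i) (D i)) ->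
  mxdiag D *m diag_mx (\row_x a (tagnat.sig1 x)) *m (mxdiag D)^T =
    \mxdiag_(i < s) ((a i)%:M : 'M[R]_(m i)).
Proof.
move=> DO; rewrite diag_mx_sig1 tr_mxdiag !mul_mxdiag; apply/eq_mxdiag => i.
by rewrite mul_mx_scalar -scalemxAl (DO i : _ = _) scalemx1.
Qed.

End BlockDiagonal.

(** * The cells of a filling, in row order and in column order *)

Section Cells.
Context {s t : nat} (eps : 'M[nat]_(s, t)).

(* A cell (i, j, e) names both a column of Q[i,j], at position cell_row, and the
   matching column of R[i,j], at position cell_col. *)
Definition cell := {i : 'I_s & {j : 'I_t & 'I_(eps i j)}}.
Local Notation rows := 'I_(\sum_i \sum_j eps i j)%N.
Local Notation cols := 'I_(\sum_j \sum_i eps i j)%N.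

Definition mk_cell i j (e : 'I_(eps i j)) : cell :=
  Tagged (fun i => {j : 'I_t & 'I_(eps i j)}) (Tagged (fun j => 'I_(eps i j)) e).

Definition cell_row (c : cell) : rows :=
  let: existT i (existT j e) := c in
  @tagnat.Rank _ (fun i => \sum_j eps i j)%N i (@tagnat.Rank _ (eps i) j e).

Definition row_cell (x : rows) : cell :=
  let: existT i k := tagnat.sig x in
  let: existT j e := tagnat.sig k in mk_cell i j e.

Definition cell_col (c : cell) : cols :=
  let: existT i (existT j e) := c in
  @tagnat.Rank _ (fun j => \sum_i eps i j)%N j (@tagnat.Rank _ (eps^~ j) i e).

Definition col_cell (y : cols) : cell :=
  let: existT j k := tagnat.sig y in
  let: existT i e := tagnat.sig k in mk_cell i j e.

Lemma row_cellK : cancel row_cell cell_row.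
Proof.
move=> x; rewrite /row_cell -[RHS]tagnat.sigK; case: (tagnat.sig x) => i k.
by rewrite -{2}[k]tagnat.sigK; case: (tagnat.sig k).
Qed.

Lemma cell_rowK : cancel cell_row row_cell.
Proof. by case=> i [j e]; rewrite /row_cell /= /tagnat.Rank tagnat.rankK/= tagnat.rankK. Qed.

Lemma col_cellK : cancel col_cell cell_col.
Proof.
move=> x; rewrite /col_cell -[RHS]tagnat.sigK; case: (tagnat.sig x) => i k.
by rewrite -{2}[k]tagnat.sigK; case: (tagnat.sig k).
Qed.

Lemma cell_colK : cancel cell_col col_cell.
Proof. by case=> i [j e]; rewrite /col_cell /= /tagnat.Rank tagnat.rankK/= tagnat.rankK. Qed.


Lemma big_cell_row {T : Type} {idx : T} (op : Monoid.com_law idx) (F : rows -> T) :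
  \big[op/idx]_x F x =
  \big[op/idx]_i \big[op/idx]_j \big[op/idx]_(e < eps i j) F (cell_row (mk_cell i j e)).
Proof. by rewrite big_Rank; apply: eq_bigr => i _; exact: big_Rank. Qed.

(** Passing through cells is a bijection from row order to column order; [rows] and [cols] stay
    distinct types, since their bounds sum [eps] in different orders. *)
Lemma big_cell_col {T : Type} {idx : T} (op : Monoid.com_law idx) (F : cols -> T) :
  \big[op/idx]_y F y = \big[op/idx]_x F (cell_col (row_cell x)).
Proof.
apply: reindex; exists (cell_row \o @col_cell) => x _ /=.
  by rewrite cell_colK row_cellK.
by rewrite cell_rowK col_cellK.
Qed.

Lemma sig1_cell_row i j (e : 'I_(eps i j)) :
  tagnat.sig1 (cell_row (mk_cell i j e)) = i.
Proof. exact: tagnat.Rank1K. Qed.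

Lemma sig1_cell_col i j (e : 'I_(eps i j)) :
  tagnat.sig1 (cell_col (mk_cell i j e)) = j.
Proof. exact: tagnat.Rank1K. Qed.

End Cells.

(** * Diagonalizing [A] and [B] at a point of [F_eps] *)

Lemma F_eps_diagonalization {R : realType} {n s t : nat}
    {m : 'I_s -> nat} {p : 'I_t -> nat}
    (hm : (\sum_(i < s) m i)%N = n) (hp : (\sum_(j < t) p j)%N = n)
    (eps : 'M[nat]_(s, t)) (heps : perfect_filling m p eps) (X : 'M[R]_n) :
  F_eps R hm hp heps X ->
  exists (U V : 'M[R]_n) (r : 'I_n -> 'I_s) (c : 'I_n -> 'I_t),
    [/\ U^T *m U = 1%:M, V^T *m V = 1%:M & X = U *m V^T] /\
    [/\ forall a, block_scalar_mx hm a = U *m diag_mx (\row_x a (r x)) *m U^T,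
        forall b, block_scalar_mx hp b = V *m diag_mx (\row_x b (c x)) *m V^T &
        forall F : 'I_s -> 'I_t -> nat,
          (\sum_x F (r x) (c x) = \sum_i \sum_j eps i j * F i j)%N].
Proof.
move=> [Q [P [QO PO ->]]].
(* Once the sizes are literally the sums of [eps], the only nontrivial cast left is the one along
   [hp], named [ch] below. *)
have mE : m = fun i => (\sum_j eps i j)%N.
  by apply/funext => i; rewrite heps.1.
have pE : p = fun j => (\sum_i eps i j)%N.
  by apply/funext => j; rewrite heps.2.
subst m p n.
(* [tau] reorders the columns of [mxdiag P] so that column [x] of [mxdiag Q] and column [x] of [V]
   belong to the same cell. *)
pose tau (x : 'I_(\sum_i \sum_j eps i j)) := cell_col _ (row_cell _ x).
pose ch := cast_ord (esym hp).
pose V : 'M[R]_(\sum_i \sum_j eps i j) := \matrix_(x, z) mxdiag P (ch x) (tau z).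
exists (mxdiag Q), V, tagnat.sig1, (fun x => tagnat.sig1 (tau x)).
split; split.
- by apply: mulmx1C; exact: mxdiag_orthogonal.
- apply: mulmx1C; apply/matrixP => x y.
  transitivity ((mxdiag P *m (mxdiag P)^T) (ch x) (ch y)).
    rewrite [LHS]mxE [RHS]mxE [RHS]big_cell_col; apply: eq_bigr => z _.
    by rewrite [V x z]mxE [V^T z y]mxE [V y z]mxE [_^T _ (ch y)]mxE.
  by rewrite mxdiag_orthogonal// !mxE (inj_eq (@cast_ord_inj _ _ _)).
- apply/matrixP => x y; rewrite castmxE [cast_ord _ x]cast_ord_id -/ch.
  rewrite [RHS]mxE big_cell_row.
  under [RHS]eq_bigr => i _.
    under eq_bigr => j _.
      under eq_bigr => e _.
        rewrite [V^T _ y]mxE [V y _]mxE /tau cell_rowK.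
        over.
      over.
    over.
  (* With [x] in row block [i] and [ch y] in column block [j], block-diagonality kills every cell
     outside [(i, j)]; the surviving sum over [e] is an entry of [Q[i,j] R[i,j]^T]. *)
  rewrite /= -(tagnat.sig2K x) -(tagnat.sig2K (ch y)).
  set i := tagnat.sig1 x; set k := tagnat.sig2 x.
  set j := tagnat.sig1 (ch y); set l := tagnat.sig2 (ch y).
  rewrite mxblock_Rank [LHS]mxE [RHS](bigD1 i)//= [X in _ = _ + X]big1 ?addr0; last first.
    move=> i' ii'; apply: big1 => j' _; apply: big1 => e _.
    by rewrite mxdiag_Rank_neq ?mul0r// eq_sym.
  rewrite [RHS](bigD1 j)//= [X in _ = _ + X]big1 ?addr0; last first.
    move=> j' jj'; apply: big1 => e _.
    by rewrite [X in _ * X]mxdiag_Rank_neq ?mulr0// eq_sym.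
  apply: eq_bigr => e _; rewrite !mxdiag_Rank [_^T e l]mxE.
  rewrite /left_block /right_block.
  rewrite (eq_irrelevance (esym (heps.1 i)) erefl) (eq_irrelevance (esym (heps.2 j)) erefl).
  by rewrite !castmx_id !mxE.
- by move=> a; rewrite mxdiag_conj.
- move=> b; apply/matrixP => x y; rewrite castmxE -/ch -(mxdiag_conj P)//.
  rewrite !mul_mx_diag [LHS]mxE [RHS]mxE [LHS]big_cell_col.
  apply: eq_bigr => z _.
  rewrite [_^T _ (ch y)]mxE [V^T z y]mxE [V y z]mxE; congr (_ * _).
  rewrite [LHS]mxE [RHS]mxE [V x z]mxE; congr (_ * _).
  by rewrite [LHS]mxE [RHS]mxE.
- move=> F.
  rewrite big_cell_row; apply: eq_bigr => i _; apply: eq_bigr => j _.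
  under eq_bigr => e _.
    rewrite sig1_cell_row /tau cell_rowK sig1_cell_col.
    over.
  by rewrite sum_nat_const card_ord.
Qed.

(** * Counting increasing pairs and conclusion *)

Lemma increasing_lt {R : realType} {s : nat} (a : 'I_s -> R) :
  (forall i k : 'I_s, (i < k)%N -> a i < a k) ->
  forall i k : 'I_s, (a i < a k) = (i < k)%N.
Proof.
move=> a_incr i k; case: (ltngtP i k) => [/a_incr//|/a_incr/ltW|/val_inj->].
  by rewrite leNgt => /negbTE.
exact: ltxx.
Qed.

(** The cardinal is a double sum of the indicator [N]; the hypothesis is applied to the second index
    with the first fixed, then to the first index with the resulting inner sum as [F]. *)
Lemma card_increasing_pairs {n s t : nat} (r : 'I_n -> 'I_s) (c : 'I_n -> 'I_t)
    (eps : 'M[nat]_(s, t)) :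
  (forall F : 'I_s -> 'I_t -> nat,
    \sum_x F (r x) (c x) = \sum_i \sum_j eps i j * F i j)%N ->
  #|[set xy : 'I_n * 'I_n | (r xy.1 < r xy.2)%N && (c xy.1 < c xy.2)%N]%SET| =
  (\sum_(i < s) \sum_(j < t) \sum_(k < s | (i < k)%N)
     \sum_(l < t | (j < l)%N) eps i j * eps k l)%N.
Proof.
move=> cellE; rewrite -sum1dep_card big_mkcond/=.
pose N i j i' j' : nat := ((i < i')%N && (j < j')%N).
rewrite -(pair_bigA _ (fun x y => N (r x) (c x) (r y) (c y)))/=.
under eq_bigr => x _ do rewrite (cellE (N (r x) (c x))).
rewrite (cellE (fun i j => \sum_k \sum_l eps k l * N i j k l)%N).
apply: eq_bigr => i _; apply: eq_bigr => j _.
rewrite big_distrr/= [RHS]big_mkcond/=; apply: eq_bigr => k _.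
rewrite /N; case: (i < k)%N; last by rewrite big1 ?muln0// => l _; rewrite muln0.
rewrite big_distrr/= [RHS]big_mkcond/=; apply: eq_bigr => l _.
by case: (j < l)%N; rewrite ?muln1 ?muln0.
Qed.

Theorem corollary2p17 (R : realType) (n s t : nat)
    (m : 'I_s -> nat) (p : 'I_t -> nat) (a : 'I_s -> R) (b : 'I_t -> R)
    (n_ge1 : (1 <= n)%N)
    (m_ge1 : forall i, (1 <= m i)%N) (p_ge1 : forall j, (1 <= p j)%N)
    (hm : (\sum_(i < s) m i)%N = n) (hp : (\sum_(j < t) p j)%N = n)
    (a_incr : forall i k : 'I_s, (i < k)%N -> a i < a k)
    (b_incr : forall j l : 'I_t, (j < l)%N -> b j < b l)
    (eps : 'M[nat]_(s, t)) (heps : perfect_filling m p eps) :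
  let f := trace_function (block_scalar_mx hm a) (block_scalar_mx hp b) in
  forall X : 'M[R]_n, F_eps R hm hp heps X ->
    critical_point f X /\
    hessian_index f X
      (\sum_(i < s) \sum_(j < t) \sum_(k < s | (i < k)%N)
         \sum_(l < t | (j < l)%N) eps i j * eps k l)%N.
Proof.
move=> f X /F_eps_diagonalization[U [V [r [c [[UO VO ->] [AE BE cellE]]]]]].
rewrite /f AE BE -(card_increasing_pairs r c)//.
have := diagonalized_index U V (\row_x a (r x)) (\row_x b (c x)) UO VO.
congr (_ /\ hessian_index _ _ _).
apply: eq_card => -[x y]; rewrite !inE/= !mxE.
by rewrite (increasing_lt a)// (increasing_lt b).
Qed.
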